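(* Let $(X,\varphi)$ be a free permutation rack with set of orbits $S=X/\varphi$. For $n\geqslant 1$ there are natural isomorphisms $$\mathrm{HR}_n(X,\varphi)\;\cong\;\overline{\mathbb{Z}S}^{\otimes(n-1)}\otimes\mathbb{Z}S,$$ where $\mathbb{Z}S$ is the free abelian group on the set $S$, and $\overline{\mathbb{Z}S}\subseteq\mathbb{Z}S$ is the free abelian subgroup of linear combinations whose coefficients add up to zero. In particular, the homology is a free abelian group in each degree. If the number $|S|=r$ of orbits is finite, then $$r(r-1)^{n-1}=(r-1)^n+(r-1)^{n-1}$$ is the $n$-th Betti number (that is, the rank of $\mathrm{HR}_n(X,\varphi)$) of the free permutation rack.
   Context: A rack $(X,\rhd)$ is a set $X$ with a binary operation $\rhd$ such that every left multiplication $y\mapsto x\rhd y$ is a bijection and $x\rhd(y\rhd z)=(x\rhd y)\rhd(x\rhd z)$ for all $x,y,z\in X$. A permutation rack $(X,\varphi)$ is a set $X$ with a permutation $\varphi\colon X\to X$ and the rack operation $x\rhd y=\varphi(y)$. It is called free if all orbits of $\varphi$ are infinite, i.e. the action of $\mathbb{Z}$ on $X$ by $n\mapsto\varphi^n$ is free. Rack homology: let $\mathrm{CR}_n(X,\varphi)=(\mathbb{Z}X)^{\otimes n}=\mathbb{Z}(X^n)$ for $n\geqslant 0$ (so $\mathrm{CR}_0=\mathbb{Z}$), with basis elements written as noncommutative monomials $x_1\cdots x_n$, and differential $\mathrm{d}\colon\mathrm{CR}_n\to\mathrm{CR}_{n-1}$, $$\mathrm{d}(x_1\cdots x_n)=\sum_{k=1}^{n-1}(-1)^{k-1}\bigl(x_1\cdots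 x_{k-1}x_{k+1}\cdots x_n-x_1\cdots x_{k-1}\,\varphi(x_{k+1})\cdots\varphi(x_n)\bigr).$$ The rack homology $\mathrm{HR}_n(X,\varphi)$ is the $n$-th homology of this chain complex. Tensor products are over $\mathbb{Z}$. Naturality is with respect to morphisms of free permutation racks, i.e. maps commuting with the permutations. *)

(* Defs.v *)
From HB Require Import structures.
From mathcomp Require Import all_boot all_order all_algebra.
From mathcomp Require Import boolp classical_sets cardinality.
From mathcomp Require Import freeg zify.

Set Implicit Arguments.
Unset Strict Implicit.
Unset Printing Implicit Defensive.

Import GRing.Theory.
Local Open Scope ring_scope.
Local Open Scope quotient_scope.

Section Kernel.
Variables (U V : zmodType) (f : {additive U -> V}).

Definition kerp : {pred U} := [pred x | f x == 0].

Fact kerp_zmod_closed : zmod_closed kerp.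
Proof.
split=> [|x y]; rewrite !inE ?raddf0 // => /eqP fx /eqP fy.
by rewrite raddfB fx fy subrr.
Qed.

HB.instance Definition _ := GRing.isZmodClosed.Build U kerp kerp_zmod_closed.

Record kernel := Kernel { kval : U; _ : kval \in kerp }.

HB.instance Definition _ := [isSub for kval].
HB.instance Definition _ := [Choice of kernel by <:].
HB.instance Definition _ := [SubChoice_isSubZmodule of kernel by <:].

Lemma kvalP (x : kernel) : f (kval x) = 0.
Proof. by case: x => x /= /eqP. Qed.

End Kernel.

Section KernelMap.
Variables (U V U' V' : zmodType) (f : {additive U -> V}).
Variables (f' : {additive U' -> V'}) (a : {additive U -> U'}).
Hypothesis fa : forall x, f x = 0 -> f' (a x) = 0.

Fact kernel_map_subproof (x : kernel f) : a (kval x) \in kerp f'.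
Proof. by rewrite inE fa ?kvalP. Qed.

Definition kernel_map (x : kernel f) : kernel f' :=
  Kernel (kernel_map_subproof x).

Fact kernel_map_is_zmod_morphism : zmod_morphism kernel_map.
Proof. by move=> x y; apply: val_inj; rewrite /= !raddfB. Qed.

HB.instance Definition _ := GRing.isZmodMorphism.Build _ _ kernel_map
  kernel_map_is_zmod_morphism.
End KernelMap.

Section QuotientLift.
Variables (U V : zmodType) (I : zmodClosed U) (h : {additive U -> V}).
Hypothesis hI : forall x, x \in I -> h x = 0.

(* The dummy let keeps hI an argument of quot_lift, so that additivity can be
   inferred as a canonical instance. *)
Definition quot_lift (q : Quotient.quot I) : V := let _ := hI in h (repr q).

Lemma quot_liftE x : quot_lift (\pi x) = h x.
Proof.
apply/eqP; rewrite -subr_eq0 -raddfB; apply/eqP/hI.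
by rewrite Quotient.idealrBE reprK.
Qed.

Fact quot_lift_is_zmod_morphism : zmod_morphism quot_lift.
Proof.
elim/quotW=> x; elim/quotW=> y.
by rewrite -raddfB !quot_liftE raddfB.
Qed.

HB.instance Definition _ := GRing.isZmodMorphism.Build _ _ quot_lift
  quot_lift_is_zmod_morphism.
End QuotientLift.

Section FreegLift.
Variables (K : choiceType) (M : zmodType) (f : K -> M).

Definition zlift (D : {freeg K}) : M := \sum_(x <- dom D) f x *~ coeff x D.

Lemma zlift_sub (s : seq K) (D : {freeg K}) :
  uniq s -> {subset dom D <= s} -> zlift D = \sum_(x <- s) f x *~ coeff x D.
Proof.
move=> us sub; rewrite [RHS](bigID (mem (dom D))) /= [X in _ + X]big1.
  rewrite addr0 -big_filter; apply: perm_big; apply: uniq_perm.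
  - exact: uniq_dom.
  - exact: filter_uniq.
  - move=> x; rewrite mem_filter; case: (boolP (x \in dom D)) => //= /sub -> //.
by move=> x /coeff_outdom ->; rewrite mulr0z.
Qed.

Fact zlift_is_zmod_morphism : zmod_morphism zlift.
Proof.
move=> D1 D2; pose s := undup (dom D1 ++ dom D2).
rewrite !(@zlift_sub s) ?undup_uniq //.
- by rewrite -sumrB; apply: eq_bigr => x _; rewrite coeffB mulrzBr.
- by move=> x xD; rewrite mem_undup mem_cat xD orbT.
- by move=> x xD; rewrite mem_undup mem_cat xD.
- by move=> x /domB xD; rewrite mem_undup.
Qed.

HB.instance Definition _ := GRing.isZmodMorphism.Build _ _ zlift
  zlift_is_zmod_morphism.

Lemma zliftU x : zlift << x >> = f x.
Proof. by rewrite /zlift domU1 big_seq1 coeffU eqxx mulr1. Qed.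
End FreegLift.

Definition freeg_map (K L : choiceType) (f : K -> L) :
    {additive {freeg K} -> {freeg L}} :=
  zlift (fun x => << f x >> : {freeg L}).

Lemma freeg_additive_ext (K : choiceType) (M : zmodType)
    (f g : {additive {freeg K} -> M}) :
  (forall x, f << x >> = g << x >>) -> f =1 g.
Proof.
move=> fg D; rewrite -(freeg_sumE D) !raddf_sum; apply: eq_bigr => x _ /=.
by rewrite -[coeff x D]intz -freegU_mulz !raddfMz fg.
Qed.

Section Tensor.
Variables A B : zmodType.

Inductive tensor_rel : {freeg (A * B)%type} -> Prop :=
| TensorRelDl a a' b :
    tensor_rel (<< (a + a', b) >> - << (a, b) >> - << (a', b) >>)
| TensorRelDr a b b' :
    tensor_rel (<< (a, b + b') >> - << (a, b) >> - << (a, b') >>)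
| TensorRel0 : tensor_rel 0
| TensorRelB x y : tensor_rel x -> tensor_rel y -> tensor_rel (x - y).

Definition tensor_relb : {pred {freeg (A * B)%type}} :=
  fun x => `[< tensor_rel x >].

Fact tensor_relb_zmod_closed : zmod_closed tensor_relb.
Proof.
split=> [|x y]; first exact/asboolP/TensorRel0.
by move=> /asboolP ? /asboolP ?; apply/asboolP/TensorRelB.
Qed.

HB.instance Definition _ :=
  GRing.isZmodClosed.Build _ tensor_relb tensor_relb_zmod_closed.

Definition tensor : zmodType := Quotient.quot tensor_relb.

Definition pure (a : A) (b : B) : tensor := \pi << (a, b) >>.

Lemma pureDl a a' b : pure (a + a') b = pure a b + pure a' b.
Proof.
rewrite /pure -raddfD; apply/eqP; rewrite -Quotient.idealrBE.
by rewrite opprD addrA; apply/asboolP/TensorRelDl.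
Qed.

Lemma pureDr a b b' : pure a (b + b') = pure a b + pure a b'.
Proof.
rewrite /pure -raddfD; apply/eqP; rewrite -Quotient.idealrBE.
by rewrite opprD addrA; apply/asboolP/TensorRelDr.
Qed.

Section Lift.
Variables (M : zmodType) (h : A -> B -> M).
Hypothesis hDl : forall a a' b, h (a + a') b = h a b + h a' b.
Hypothesis hDr : forall a b b', h a (b + b') = h a b + h a b'.

Fact tensor_lift_subproof x :
  x \in tensor_relb -> zlift (fun p : A * B => h p.1 p.2) x = 0.
Proof.
move=> /asboolP; elim=> [a a' b|a b b'||{}x y _ x0 _ y0].
- by rewrite !raddfB /= !zliftU /= hDl addrAC addrK subrr.
- by rewrite !raddfB /= !zliftU /= hDr addrAC addrK subrr.
- by rewrite raddf0.
- by rewrite raddfB /= x0 y0 subrr.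
Qed.

Definition tensor_lift : {additive tensor -> M} :=
  quot_lift tensor_lift_subproof.

Lemma tensor_liftE a b : tensor_lift (pure a b) = h a b.
Proof. by rewrite [LHS]quot_liftE /= zliftU. Qed.
End Lift.
End Tensor.

Section TensorMap.
Variables (A B A' B' : zmodType).
Variables (f : {additive A -> A'}) (g : {additive B -> B'}).

Fact tensor_map_Dl a a' b :
  pure (f (a + a')) (g b) = pure (f a) (g b) + pure (f a') (g b).
Proof. by rewrite raddfD pureDl. Qed.

Fact tensor_map_Dr a b b' :
  pure (f a) (g (b + b')) = pure (f a) (g b) + pure (f a) (g b').
Proof. by rewrite raddfD pureDr. Qed.

Definition tensor_map : {additive tensor A B -> tensor A' B'} :=
  tensor_lift (h := fun a b => pure (f a) (g b)) tensor_map_Dl tensor_map_Dr.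

Lemma tensor_mapE a b : tensor_map (pure a b) = pure (f a) (g b).
Proof. exact: tensor_liftE. Qed.
End TensorMap.

Fixpoint tensor_pow (A : zmodType) (n : nat) : zmodType :=
  if n is m.+1 then tensor A (tensor_pow A m) else int.

Fixpoint tensor_pow_map (A B : zmodType) (f : {additive A -> B}) (n : nat) :
    {additive tensor_pow A n -> tensor_pow B n} :=
  if n is m.+1 then tensor_map f (tensor_pow_map f m)
  else (idfun : {additive int -> int}).

Definition is_free_abelian (A : zmodType) : Prop :=
  exists (K : choiceType) (f : {additive {freeg K} -> A}), bijective f.

Definition int_indep (A : zmodType) (k : nat) (v : 'I_k -> A) : Prop :=
  forall c : 'I_k -> int, \sum_i v i *~ c i = 0 -> forall i, c i = 0.

(* Finite Z-rank as the maximal size of a Z-linearly independent family. *)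
Definition has_rank (A : zmodType) (r : nat) : Prop :=
  (exists v : 'I_r -> A, int_indep v) /\
  (forall k (v : 'I_k -> A), int_indep v -> (k <= r)%N).

Section Homology.
Variables (U V W : zmodType) (f : {additive U -> V}) (g : {additive V -> W}).

Definition boundaryb : {pred kernel g} :=
  fun z => `[< exists u, f u = kval z >].

Fact boundaryb_zmod_closed : zmod_closed boundaryb.
Proof.
split=> [|x y]; first by apply/asboolP; exists 0; rewrite raddf0.
move=> /asboolP[u fu] /asboolP[v fv]; apply/asboolP; exists (u - v).
by rewrite raddfB fu fv.
Qed.

HB.instance Definition _ :=
  GRing.isZmodClosed.Build _ boundaryb boundaryb_zmod_closed.

(* The quotient is by the intersection of the image of f with the kernel of g,
   which is the whole image when g \o f = 0; see CRd_CRd below. *)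
Definition homology : zmodType := Quotient.quot boundaryb.

Definition hclass (z : kernel g) : homology := \pi z.
End Homology.

Arguments boundaryb {U V W} f g _.

Section HomologyMap.
Variables (U V W U' V' W' : zmodType).
Variables (f : {additive U -> V}) (g : {additive V -> W}).
Variables (f' : {additive U' -> V'}) (g' : {additive V' -> W'}).
Variables (a : {additive U -> U'}) (b : {additive V -> V'}).
Variables (c : {additive W -> W'}).
Hypothesis abf : forall x, f' (a x) = b (f x).
Hypothesis bcg : forall x, g' (b x) = c (g x).

Fact homology_map_subproof1 x : g x = 0 -> g' (b x) = 0.
Proof. by move=> gx; rewrite bcg gx raddf0. Qed.

Let h : {additive kernel g -> homology f' g'} :=
  \pi_(homology f' g') \o kernel_map homology_map_subproof1.

Fact homology_map_subproof2 (z : kernel g) : z \in boundaryb f g -> h z = 0.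
Proof.
move=> /asboolP[u fu]; apply/eqP.
rewrite -(raddf0 \pi_(homology f' g')) /= -Quotient.idealrBE subr0.
by apply/asboolP; exists (a u); rewrite abf fu.
Qed.

Definition homology_map : {additive homology f g -> homology f' g'} :=
  quot_lift homology_map_subproof2.

Lemma homology_mapE z :
  homology_map (hclass f z) = hclass f' (kernel_map homology_map_subproof1 z).
Proof. exact: quot_liftE. Qed.
End HomologyMap.

(* The rack operation x |> y = phi y is determined by phi, so it is not recorded
   separately. *)
Record permRack := PermRack {
  psort :> choiceType;
  phi : psort -> psort;
  phiV : psort -> psort;
  phiK : cancel phi phiV;
  phiVK : cancel phiV phi }.

Arguments phi {p} _.
Arguments phiV {p} _.

Section Orbits.
Variable X : permRack.
Implicit Types (x y : X) (k l : int).

Definition phiz k x : X :=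
  match k with
  | Posz n => iter n phi x
  | Negz n => iter n.+1 phiV x
  end.

Lemma phizS k x : phiz (k + 1) x = phi (phiz k x).
Proof.
case: k => [n|[|n]]; first by rewrite -PoszD addn1.
- by rewrite NegzE addNr /= phiVK.
- have -> : Negz n.+1 + 1 = Negz n.
    by rewrite !NegzE -[n.+2]addn1 PoszD opprD addrNK.
  by rewrite /= phiVK.
Qed.

Lemma phizP k x : phiz (k - 1) x = phiV (phiz k x).
Proof. by rewrite -{2}[k](subrK 1) phizS phiK. Qed.

Lemma phizD k l x : phiz (k + l) x = phiz k (phiz l x).
Proof.
elim/int_ind: k => [|n IH|n IH]; first by rewrite add0r.
- by rewrite -addn1 PoszD addrAC !phizS IH.
- by rewrite -addn1 PoszD opprD addrAC !phizP IH.
Qed.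

Definition orbit_rel : rel X := fun x y => `[< exists k, phiz k x = y >].

Fact orbit_rel_equiv : equiv_class_of orbit_rel.
Proof.
split=> [x|x y|y x z]; first by apply/asboolP; exists 0.
- have sym u v : orbit_rel u v -> orbit_rel v u.
    move=> /asboolP[k <-]; apply/asboolP; exists (- k).
    by rewrite -phizD addNr.
  by apply/idP/idP; apply: sym.
- move=> /asboolP[k <-] /asboolP[l <-]; apply/asboolP; exists (l + k).
  by rewrite phizD.
Qed.

Canonical orbit_equiv := EquivRelPack orbit_rel_equiv.
Canonical orbit_encModRel := defaultEncModRel orbit_rel.

Definition orbits := {eq_quot orbit_rel}.

HB.instance Definition _ := Choice.on orbits.
HB.instance Definition _ : EqQuotient X orbit_rel orbits := EqQuotient.on orbits.
End Orbits.

Record freePermRack := FreePermRack {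
  fsort :> permRack;
  phiz_free : forall (k : int) (x : fsort), phiz k x = x -> k = 0 }.

Record permRackHom (X Y : permRack) := PermRackHom {
  hom_fun :> X -> Y;
  hom_phi : forall x, hom_fun (phi x) = phi (hom_fun x) }.

Section OrbitsMap.
Variables (X Y : permRack) (F : permRackHom X Y).

Definition orbits_map (s : orbits X) : orbits Y := \pi_(orbits Y) (F (repr s)).

Lemma hom_phiV x : F (phiV x) = phiV (F x).
Proof. by rewrite -{2}[x]phiVK hom_phi phiK. Qed.

Lemma hom_phiz k x : F (phiz k x) = phiz k (F x).
Proof.
elim/int_ind: k => [|n IH|n IH] //.
- by rewrite -addn1 PoszD !phizS hom_phi IH.
- by rewrite -addn1 PoszD opprD !phizP hom_phiV IH.
Qed.

Lemma orbits_mapE x : orbits_map (\pi x) = \pi_(orbits Y) (F x).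
Proof.
apply/eqmodP; rewrite /= /orbit_rel.
have /eqmodP/asboolP[k E] : repr (\pi_(orbits X) x) = x %[mod orbits X].
  by rewrite reprK.
by apply/asboolP; exists k; rewrite -hom_phiz E.
Qed.
End OrbitsMap.

Definition aug (S : choiceType) : zmodType := kernel (@deg S).

Section AugMap.
Variables (S T : choiceType) (f : S -> T).

Lemma deg_freeg_map D : deg (freeg_map f D) = deg D.
Proof.
apply: (freeg_additive_ext (f := @deg T \o freeg_map f)) => x /=.
by rewrite zliftU !degU.
Qed.

Fact aug_map_subproof D : deg D = 0 -> deg (freeg_map f D) = 0.
Proof. by rewrite deg_freeg_map. Qed.

Definition aug_map : {additive aug S -> aug T} := kernel_map aug_map_subproof.
End AugMap.

Section RackComplex.
Variable X : permRack.

Definition CR (n : nat) : zmodType := {freeg (n.-tuple X)}.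

Definition face0 n (k : 'I_n) (x : n.-tuple X) : n.-1.-tuple X :=
  [tuple tnth x (fintype.lift k i) | i < n.-1].

Definition face1 n (k : 'I_n) (x : n.-tuple X) : n.-1.-tuple X :=
  [tuple (if (i < k)%N then tnth x (fintype.lift k i) else phi (tnth x (fintype.lift k i)))
    | i < n.-1].

(* Positions are counted from 0: with k for the usual k-1, the differential is
     d (x_0 ... x_(n-1)) = \sum_(k < n-1) (-1)^k
       (x_0 ... x_(k-1) x_(k+1) ... x_(n-1)
        - x_0 ... x_(k-1) phi(x_(k+1)) ... phi(x_(n-1))),
   so the last letter is never deleted.  For n = 0 the sum is empty and CRd 0
   is the zero map on CR 0, which has the right kernel. *)
Definition CRd n : {additive CR n -> CR n.-1} :=
  zlift (fun x : n.-tuple X =>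
    \sum_(k < n | (k.+1 < n)%N)
      (<< face0 k x >> - << face1 k x >> : CR n.-1) *~ (-1) ^+ k).

Lemma face_face (a b : bool) m (j : 'I_m.+2) (k : 'I_m.+1) (j' : 'I_m.+2)
    (k' : 'I_m.+1) (x : m.+2.-tuple X) :
  (k < j)%N -> j' = k :> nat -> k' = j.-1 :> nat ->
  (if a then face1 k else face0 k) ((if b then face1 j else face0 j) x) =
  (if b then face1 k' else face0 k') ((if a then face1 j' else face0 j') x).
Proof.
move=> kj ej ek; have jS : j = j.-1.+1 :> nat by rewrite prednK // (leq_ltn_trans _ kj).
have Eab i : fintype.lift j (fintype.lift k i) =
             fintype.lift j' (fintype.lift k' i).
  by apply: val_inj; rewrite /= ej ek /bump; lia.
case: a; case: b; apply: eq_from_tnth => i; rewrite !tnth_mktuple Eab //=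
  ?ej ?ek /bump; by do ?[case: ltnP => ?] => //; lia.
Qed.

Lemma sum_faces_eq0 (M : zmodType) m (G : nat -> nat -> M) :
  (forall j k, (k < j < m.+1)%N -> G j k = G k j.-1) ->
  \sum_(0 <= j < m.+1) \sum_(0 <= k < m) G j k *~ (-1) ^+ (j + k) = 0.
Proof.
move=> GG; pose H j k := G j k *~ (-1) ^+ (j + k).
pose A := \sum_(0 <= j < m.+1) \sum_(0 <= k < m) if (k < j)%N then H j k else 0.
pose B := \sum_(0 <= j < m.+1) \sum_(0 <= k < m) if (k < j)%N then 0 else H j k.
transitivity (A + B).
  rewrite -big_split; apply: eq_bigr => j _ /=.
  rewrite -big_split; apply: eq_bigr => k _ /=.
  by case: ifP => _; rewrite ?addr0 ?add0r.
rewrite {}/A {}/B exchange_big_nat [X in _ + X]big_nat_recr //=.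
rewrite [X in _ + (_ + X)]big_nat_cond [X in _ + (_ + X)]big1 ?addr0; last first.
  by move=> k /andP[/andP[_ ->]].
rewrite -big_split /= big_nat_cond big1 // => a /andP[/andP[_ am] _].
rewrite big_nat_recl //= add0r -big_split /= big_nat_cond big1 // => b.
move=> /andP[/andP[_ bm] _]; rewrite ltnS ltnNge; case: ltnP => ab; rewrite ?addr0 //=.
rewrite /H GG /=; last by rewrite !ltnS ab.
by rewrite addSn exprS mulN1r mulrNz addnC addNr.
Qed.

Lemma CRdU n (x : n.-tuple X) :
  CRd n << x >> = \sum_(k < n | (k.+1 < n)%N)
      (<< face0 k x >> - << face1 k x >>) *~ (-1) ^+ k.
Proof. exact: zliftU. Qed.

Lemma sum_not_last (M : zmodType) m (f : 'I_m.+1 -> M) :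
  \sum_(k < m.+1 | (k.+1 < m.+1)%N) f k = \sum_(0 <= k < m) f (inord k).
Proof.
rewrite big_mkcond big_ord_recr /= ltnn addr0 big_mkord.
apply: eq_bigr => k _; rewrite ltnS ltn_ord; congr f.
by apply: val_inj; rewrite /= inordK // ltnS ltnW.
Qed.

Lemma CRd_CRd n (z : CR n.+1) : CRd n (CRd n.+1 z) = 0.
Proof.
move: z; apply: (freeg_additive_ext (f := CRd n \o CRd n.+1) (g := \0)) => x /=.
case: n x => [|m] x; first by rewrite CRdU big1 ?raddf0 // => -[].
pose F (b : bool) m (k : 'I_m) := (if b then @face1 m k else @face0 m k).
pose G j k : CR m := \sum_(a : bool) \sum_(b : bool)
   << F a m.+1 (inord k) (F b m.+2 (inord j) x) >> *~ (-1) ^+ (a + b).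
rewrite -[RHS](@sum_faces_eq0 _ m G).
  rewrite CRdU sum_not_last raddf_sum; apply: eq_big_nat => j jm.
  rewrite raddfMz raddfB /= !CRdU !sum_not_last -sumrB mulrz_suml.
  apply: eq_big_nat => k km; rewrite /G !big_bool /F /= !inordK //; try lia.
  rewrite -mulrzBl -mulrzA -exprD addnC; congr (_ *~ _).
  have E (p q r s : CR m) : p - q - (r - s) = s - q + (- r + p).
    by rewrite opprB addrC [p - q]addrC addrACA.
  by rewrite E expr0 expr1 mulr1z !mulrN1z.
move=> j k /andP[kj jm].
rewrite /G [RHS]exchange_big; apply: eq_bigr => a _; apply: eq_bigr => b _.
rewrite addnC /F; congr (<< _ >> *~ _); apply: face_face; rewrite !inordK; lia.
Qed.

Definition HR (n : nat) : zmodType := homology (CRd n.+1) (CRd n).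
End RackComplex.

Section RackComplexMap.
Variables (X Y : permRack) (F : permRackHom X Y).

Definition CR_map n : {additive CR X n -> CR Y n} :=
  freeg_map (fun x : n.-tuple X => [tuple of map F x]).

Lemma CR_mapE n z : CRd Y n (CR_map n z) = CR_map n.-1 (CRd X n z).
Proof.
apply: (freeg_additive_ext (f := CRd Y n \o CR_map n)
                           (g := CR_map n.-1 \o CRd X n)) => x /=.
rewrite !zliftU raddf_sum; apply: eq_bigr => k _.
rewrite raddfMz raddfB /= !zliftU; congr ((<< _ >> - << _ >>) *~ _).
- by apply: eq_from_tnth => i; rewrite !(tnth_map, tnth_mktuple).
- by apply: eq_from_tnth => i;
    rewrite !(tnth_map, tnth_mktuple) -hom_phi -fun_if.
Qed.

Definition HR_map n : {additive HR X n -> HR Y n} :=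
  homology_map (CR_mapE (n := n.+1)) (CR_mapE (n := n)).
End RackComplexMap.

(* Main.v *)
(** Write C_n = Z(X^n).  For a letter x and w in C_n with n >= 1,
    d(x w) = w - phi(w) - x d(w), where phi acts on all letters of w.
    Deleting the first letter of a cycle z gives some w for which phi(w) - w is
    a boundary in all but the first letter; since phi permutes letters freely
    and w has finite support, w itself is such a boundary.  Hence z is
    homologous to a sum of x w_x with cycles w_x of total sum 0.  Moreover
    (x - phi(x)) w is the boundary of phi(x) x w when w is a cycle, so only the
    orbit of x matters.

    By induction, the projection C_n -> Z(S^n) kills a cycle only if it is a
    boundary, and projected cycles are spanned by the products
    (s_1 - s_0) ... (s_(n-1) - s_0) s_n for a base orbit s_0.  The
    isomorphism is the projection followed by the map
    s_1 ... s_n |-> (s_1 - s_0) # ... # (s_(n-1) - s_0) # s_n, with # the tensor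
    product; on projected cycles it does not depend on s_0, whence
    naturality. *)
Require Import Defs.
From HB Require Import structures.
From mathcomp Require Import all_boot all_order all_algebra.
From mathcomp Require Import boolp classical_sets cardinality.
From mathcomp Require Import freeg.

Set Implicit Arguments.
Unset Strict Implicit.
Unset Printing Implicit Defensive.

Import GRing.Theory.
Local Open Scope ring_scope.

(** Closure under differences already yields negatives, sums and integer multiples of generators. *)
Lemma freeg_ind (K : choiceType) (P : {freeg K} -> Prop) :
    P 0 -> (forall x, P << x >>) -> (forall u v, P u -> P v -> P (u - v)) ->
  forall u, P u.
Proof.
move=> P0 PU PB u.
have PN v : P v -> P (- v) by move=> Pv; rewrite -sub0r; apply: PB.
have PD v w : P v -> P w -> P (v + w).
  by move=> Pv Pw; rewrite -[w]opprK; apply/PB/PN.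
rewrite -(freeg_sumE u); apply: (big_ind P) => // x _.
rewrite -[coeff x u]intz -freegU_mulz.
have Pn n : P (<< x >> *+ n) by elim: n => // n IH; rewrite mulrS; apply: PD.
by case: (coeff x u) => n; [apply: Pn | apply/PN/Pn].
Qed.

(** * Words *)

Section Words.
Variable K : choiceType.
Implicit Types (x y : K) (n : nat).

Local Notation W n := {freeg (n.-tuple K)}.

Definition wcons {n} x : {additive W n -> W n.+1} :=
  freeg_map (fun t : n.-tuple K => [tuple of x :: t]).

Definition wbehead {n} : {additive W n.+1 -> W n} :=
  freeg_map (fun t : n.+1.-tuple K => [tuple of behead t] : n.-tuple K).

(** The component w_x in the decomposition z = \sum_x x w_x by first letters. *)
Definition wcomp {n} x : {additive W n.+1 -> W n} :=
  zlift (fun t : n.+1.-tuple K =>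
    if thead t == x then << ([tuple of behead t] : n.-tuple K) >> else 0 : W n).

Definition heads n (z : W n.+1) : seq K := undup [seq thead t | t <- dom z].

Lemma wconsU n x (t : n.-tuple K) : wcons x << t >> = << [tuple of x :: t] >>.
Proof. exact: zliftU. Qed.

Lemma wordU n (t : n.+1.-tuple K) :
  << t >> = wcons (thead t) << [tuple of behead t] >>.
Proof. by rewrite {1}(tuple_eta t) wconsU. Qed.

Lemma wbeheadK n x : cancel (@wcons n x) (@wbehead n).
Proof.
apply: (freeg_additive_ext (f := @wbehead n \o @wcons n x)
  (g := idfun)) => t /=.
by rewrite !zliftU; congr << _ >>; apply: val_inj.
Qed.

Lemma wcompC n x y (w : W n) : wcomp x (wcons y w) = if y == x then w else 0.
Proof.
have E (t : n.-tuple K) : wcomp x (wcons y << t >>) =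
  if y == x then << t >> else 0.
  by rewrite wconsU [LHS]zliftU theadE; case: ifP => // _; congr << _ >>;
    apply: val_inj.
case: eqVneq E w => _ E.
  exact: (freeg_additive_ext (f := @wcomp n x \o @wcons n y) (g := idfun)).
exact: (freeg_additive_ext (f := @wcomp n x \o @wcons n y) (g := \0)).
Qed.

Lemma wcomp_out n x (z : W n.+1) : x \notin heads z -> wcomp x z = 0.
Proof.
rewrite mem_undup => xz; rewrite /wcomp /= /zlift big_seq big1 // => t tz.
by case: eqP => [tx|_]; [case/negP: xz; rewrite -tx map_f | rewrite mul0rz].
Qed.

Lemma wcomp_sum n (z : W n.+1) : \sum_(x <- heads z) wcons x (wcomp x z) = z.
Proof.
transitivity (\sum_(t <- dom z) \sum_(x <- heads z)
    wcons x (wcomp x (<< t >> : W n.+1)) *~ coeff t z).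
  rewrite exchange_big; apply: eq_bigr => x _.
  rewrite -{1}(freeg_sumE z) (raddf_sum (wcomp x)) (raddf_sum (wcons x));
    apply: eq_bigr => t _ /=.
  by rewrite -[coeff t z]intz -freegU_mulz (raddfMz (wcomp x))
    (raddfMz (wcons x)) intz.
rewrite -[RHS]freeg_sumE big_seq [RHS]big_seq; apply: eq_bigr => t tz.
rewrite -[coeff t z]intz -freegU_mulz -mulrz_suml intz; congr (_ *~ _).
rewrite (bigD1_seq (thead t)) ?undup_uniq ?mem_undup ?map_f //=.
rewrite wordU wcompC eqxx big1 ?addr0 // => x xt.
by rewrite wcompC eq_sym (negPf xt) raddf0.
Qed.

Lemma wbeheadE n (z : W n.+1) : wbehead z = \sum_(x <- heads z) wcomp x z.
Proof.
rewrite -{1}(wcomp_sum z) raddf_sum; apply: eq_bigr => x _.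
exact: wbeheadK.
Qed.

(** The product D w of a combination of letters with w. It is bundled as additive in D, because D
    will range over differences such as s - s_0. *)
Definition wmul n (w : W n) : {additive {freeg K} -> W n.+1} :=
  zlift (fun x => wcons x w).

Lemma wmulU n x (w : W n) : wmul w << x >> = wcons x w.
Proof. exact: zliftU. Qed.

Lemma wmulDr n (w1 w2 : W n) D : wmul (w1 + w2) D = wmul w1 D + wmul w2 D.
Proof.
move: D; apply: (freeg_additive_ext (g := wmul w1 \+ wmul w2)) => x /=.
by rewrite !wmulU raddfD.
Qed.

End Words.
Arguments wbehead {K n}.

(** Unlike [CR_map], this takes any map of letters: it also serves for the projection to orbits and
    for choosing orbit representatives, which need not commute with [phi]. *)
Definition wmap (K L : choiceType) (f : K -> L) {n} :
    {additive {freeg (n.-tuple K)} -> {freeg (n.-tuple L)}} :=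
  freeg_map (fun t : n.-tuple K => [tuple of map f t]).

Section WordMap.
Variables (K L : choiceType) (f : K -> L).

Lemma wmap_cons n x (w : {freeg (n.-tuple K)}) :
  wmap f (wcons x w) = wcons (f x) (wmap f w).
Proof.
move: w; apply: (freeg_additive_ext (f := @wmap _ _ f n.+1 \o @wcons _ n x)
  (g := @wcons _ n (f x) \o @wmap _ _ f n)) => t /=.
by rewrite !zliftU; congr << _ >>; apply: val_inj.
Qed.

Lemma wmap_nil (t : 0.-tuple K) : wmap f << t >> = << [tuple] >>.
Proof. by rewrite [LHS]zliftU; congr << _ >>; rewrite tuple0. Qed.

Lemma wmap_behead n (z : {freeg (n.+1.-tuple K)}) :
  wbehead (wmap f z) = wmap f (wbehead z).
Proof.
move: z; apply: (freeg_additive_ext (f := @wbehead _ _ \o @wmap _ _ f n.+1)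
  (g := @wmap _ _ f n \o @wbehead _ n)) => t /=.
by rewrite wordU wmap_cons !wbeheadK.
Qed.

End WordMap.

Lemma wmap_comp (K L M : choiceType) (f : K -> L) (g : L -> M) n z :
  wmap g (wmap f z) = wmap (g \o f) (z : {freeg (n.-tuple K)}).
Proof.
move: z; apply: (freeg_additive_ext
  (f := @wmap _ _ g n \o @wmap _ _ f n)) => t /=.
by rewrite !zliftU; congr << _ >>; apply: val_inj; rewrite /= -map_comp.
Qed.

Lemma eq_wmap (K L : choiceType) (f g : K -> L) n :
  f =1 g -> @wmap _ _ f n =1 @wmap _ _ g n.
Proof.
move=> fg; apply: freeg_additive_ext => t.
by rewrite [LHS]zliftU [RHS]zliftU; congr << _ >>; apply: val_inj;
  apply: eq_map.
Qed.

(** * The rack differential *)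

Section Differential.
Variable X : permRack.
Implicit Types (x y : X) (n : nat).

Local Notation C n := {freeg (n.-tuple X)}.
Local Notation Phi := (wmap (@phi X)).

(** [phi] is itself a morphism of permutation racks, so this is an instance of naturality. *)
Lemma CRd_Phi n (z : C n) : CRd X n (Phi z) = Phi (CRd X n z).
Proof. exact: (CR_mapE (@PermRackHom X X phi (fun x => erefl))). Qed.

Lemma CRd1 (z : C 1) : CRd X 1 z = 0.
Proof.
move: z; apply: (freeg_additive_ext (f := CRd X 1) (g := \0)) => t.
by rewrite CRdU big_pred0 // => -[[|k]].
Qed.

Lemma face_cons0 n x (t : n.-tuple X) :
  (face0 ord0 [tuple of x :: t] = t) *
  (face1 ord0 [tuple of x :: t] = [tuple of map phi t]).
Proof.
split; apply: eq_from_tnth => i.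
  by apply: etrans (tnth_mktuple _ _) _; rewrite tnthS.
by apply: etrans (tnth_mktuple _ _) _; rewrite /= tnthS tnth_map.
Qed.

Lemma face_consS n (k : 'I_n.+1) x (t : n.+1.-tuple X) :
  (face0 (fintype.lift ord0 k) [tuple of x :: t] = [tuple of x :: face0 k t]) *
  (face1 (fintype.lift ord0 k) [tuple of x :: t] = [tuple of x :: face1 k t]).
Proof.
have E i : tnth [tuple of x :: t]
    (fintype.lift (fintype.lift ord0 k) (fintype.lift ord0 i)) =
  tnth t (fintype.lift k i).
  rewrite (_ : fintype.lift _ _ =
    fintype.lift ord0 (fintype.lift k i)) ?tnthS //.
  by apply: val_inj; rewrite /= bumpS.
split; apply: eq_from_tnth => i; rewrite tnth_mktuple.
all: case: (unliftP ord0 i) => [j ->|->]; first by rewrite E tnthS tnth_mktuple.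
all: by rewrite /= !(tnth_nth x).
Qed.

(** The face at the first letter contributes w - phi(w); the later faces keep x, and their signs are
    shifted by one. The word w has length at least 1, since a sole letter is the last one and is
    never deleted. *)
Lemma CRd_cons n x (w : C n.+1) :
  CRd X n.+2 (wcons x w) = w - Phi w - wcons x (CRd X n.+1 w).
Proof.
move: w; apply: (freeg_additive_ext (f := CRd X n.+2 \o @wcons _ n.+1 x)
  (g := idfun \- Phi \- (@wcons _ n x \o CRd X n.+1))) => t.
rewrite [LHS]/= wconsU CRdU big_mkcond big_ord_recl /= mulr1z.
rewrite !face_cons0; congr (_ - _ + _).
  by rewrite [RHS]zliftU.
rewrite [X in _ = - X]/= CRdU (raddf_sum (@wcons _ n x)) -sumrN
  [RHS]big_mkcond; apply: eq_bigr => k _.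
rewrite /bump /= !add1n ltnS; case: ifP => // _.
rewrite !face_consS (raddfMz (@wcons _ n x)) raddfB /= !wconsU exprS mulN1r
  mulrNz.
by [].
Qed.

End Differential.

#[global] Opaque CRd wcons wbehead wcomp wmul wmap.

(** * Boundaries and the projection to words of orbits *)

Section Boundaries.
Variable X : permRack.
Implicit Types (x y : X) (n : nat).

Local Notation C n := {freeg (n.-tuple X)}.
Local Notation Phi := (wmap (@phi X)).
Local Notation orb := (\pi_(orbits X)%qT : X -> orbits X).
Local Notation proj := (wmap orb).

Lemma orb_phiz k x : orb (phiz k x) = orb x.
Proof. by apply/esym/eqmodP/asboolP; exists k. Qed.

Lemma proj_Phi n (z : C n) : proj (Phi z) = proj z.
Proof. by rewrite wmap_comp; apply: eq_wmap => x; apply: (orb_phiz 1). Qed.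

(** In the recursion [CRd_cons], w and phi(w) have the same projection, and x d(w) is handled by
    induction. *)
Lemma proj_CRd n (z : C n.+1) : proj (CRd X n.+1 z) = 0.
Proof.
elim: n z => [|n IH] z; first by rewrite CRd1 raddf0.
move: z; apply: (freeg_additive_ext
  (f := @wmap _ _ orb _ \o CRd X n.+2)
  (g := \0)) => t.
rewrite /= wordU CRd_cons !raddfB /= proj_Phi subrr wmap_cons IH.
by rewrite raddf0 subr0.
Qed.

Lemma wcomp_Phi n x (z : C n.+1) : wcomp (phi x) (Phi z) = Phi (wcomp x z).
Proof.
move: z; apply: (freeg_additive_ext (f := @wcomp _ n (phi x) \o @wmap _ _ phi _)
  (g := @wmap _ _ phi _ \o @wcomp _ n x)) => t /=.
rewrite wordU wmap_cons !wcompC (inj_eq (can_inj (@phiK X))).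
by case: ifP => // _; rewrite raddf0.
Qed.

(** With w = [wbehead z], summing [CRd_cons] over first letters gives d(z) = w - phi(w) - \sum_x x
    d(w_x); this is its component at x. *)
Lemma wcomp_CRd n x (z : C n.+2) :
  wcomp x (CRd X n.+2 z) =
  wcomp x (wbehead z) - wcomp x (Phi (wbehead z)) - CRd X n.+1 (wcomp x z).
Proof.
move: z; apply: (freeg_additive_ext (f := @wcomp _ _ x \o CRd X n.+2)
  (g := (@wcomp _ _ x \o wbehead) \-
        (@wcomp _ _ x \o @wmap _ _ phi _ \o wbehead)
        \- (CRd X n.+1 \o @wcomp _ _ x))) => t /=.
rewrite wordU CRd_cons wbeheadK !wcompC !raddfB /= wcompC.
by case: ifP => // _; rewrite (raddf0 (CRd X n.+1)).
Qed.

Definition bounds n (z : C n) := exists v, CRd X n.+1 v = z.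

Lemma bounds0 n : bounds (0 : C n).
Proof. by exists 0; rewrite raddf0. Qed.

Lemma boundsB n (z w : C n) : bounds z -> bounds w -> bounds (z - w).
Proof. by move=> [u <-] [v <-]; exists (u - v); rewrite raddfB. Qed.

Lemma boundsN n (z : C n) : bounds z -> bounds (- z).
Proof. by move=> bz; rewrite -sub0r; apply: boundsB => //; apply: bounds0. Qed.

Lemma boundsD n (z w : C n) : bounds z -> bounds w -> bounds (z + w).
Proof. by move=> bz bw; rewrite -[w]opprK; apply/boundsB/boundsN. Qed.

Lemma bounds_trans n (u v w : C n) :
  bounds (u - v) -> bounds (v - w) -> bounds (u - w).
Proof. by move=> uv vw; rewrite -[u](subrK v) -addrA; apply: boundsD. Qed.

Lemma bounds_sum n (I : Type) (s : seq I) (P : pred I) (F : I -> C n) :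
  (forall i, P i -> bounds (F i)) -> bounds (\sum_(i <- s | P i) F i).
Proof.
by move=> bF; apply: (big_ind (@bounds n)) => //;
  [apply: bounds0 | apply: boundsD].
Qed.

Lemma bounds_Phi n (z : C n) : bounds z -> bounds (Phi z).
Proof. by move=> [v <-]; exists (Phi v); rewrite CRd_Phi. Qed.

Lemma proj_bounds n (z w : C n) : bounds (z - w) -> proj z = proj w.
Proof.
move=> [v /(congr1 proj)/eqP].
by rewrite proj_CRd raddfB eq_sym subr_eq0 => /eqP.
Qed.

Lemma bounds_phi n x (w : C n.+1) : CRd X n.+1 w = 0 ->
  bounds (wcons x w - wcons (phi x) w).
Proof.
move=> dw; exists (wcons (phi x) (wcons x w)).
rewrite !CRd_cons dw raddf0 subr0 wmap_cons raddfB opprB.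
by rewrite addrA subrK.
Qed.

(** The case of an empty word, which [bounds_phi] leaves out: d(y x) = x - phi(x) for every letter
    y, here with y = x. *)
Lemma bounds_letter x (t : C 0) : bounds (wcons x t - wcons (phi x) t).
Proof.
exists (wcons x (wcons x t)).
rewrite CRd_cons CRd1 raddf0 subr0 wmap_cons; congr (_ - wcons _ _).
move: t; apply: (freeg_additive_ext (f := @wmap _ _ phi 0) (g := idfun)) => t.
by rewrite tuple0 wmap_nil.
Qed.

(** The first letter moves along its orbit one step at a time, in both directions. The hypothesis is
    shaped to accept both [bounds_phi] and [bounds_letter]. *)
Lemma bounds_orbit n x y (w : C n) :
    (forall u, bounds (wcons u w - wcons (phi u) w)) -> orb x = orb y ->
  bounds (wcons x w - wcons y w).
Proof.
move=> bw /eqmodP/asboolP[k <-]; elim/int_ind: k => [|k IH|k IH].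
- by rewrite subrr; apply: bounds0.
- have -> : k.+1%:Z = k%:Z + 1 by rewrite -PoszD addn1.
  by rewrite phizS; apply: bounds_trans IH (bw _).
- have -> : - k.+1%:Z = - k%:Z - 1 by rewrite -opprD -PoszD addn1.
  rewrite phizP; apply: bounds_trans IH _; rewrite -opprB; apply: boundsN.
  by rewrite -{2}[phiz (- k%:Z) x]phiVK; apply: bw.
Qed.

End Boundaries.

(** * Cycles and boundaries *)

Section Cycles.
Variable X : freePermRack.
Implicit Types (x y : X) (n : nat).

Local Notation C n := {freeg (n.-tuple X)}.
Local Notation Phi := (wmap (@phi X)).
Local Notation orb := (\pi_(orbits X)%qT : X -> orbits X).
Local Notation proj := (wmap orb).

Lemma phiz_inj x : injective (fun k => phiz k x).
Proof.
move=> k l /= kl; apply/eqP; rewrite -subr_eq0 addrC; apply/eqP.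
by apply: (@phiz_free X _ x); rewrite phizD kl -phizD addNr.
Qed.

Lemma iter_phiV_phiz k x : iter k phiV x = phiz (- k%:Z) x.
Proof. by case: k => // k; rewrite -NegzE. Qed.

(* The set of letters x violating the conclusion is stable under phiV and
   finite, hence empty because the action is free. *)
Lemma bounds_wcomp n (w : C n.+1) :
    (forall x, bounds (wcomp x w - Phi (wcomp (phiV x) w))) ->
  forall x, bounds (wcomp x w).
Proof.
move=> bw x; apply: contrapT => nb.
have nbk k : ~ bounds (wcomp (iter k phiV x) w).
  elim: k => //= k IH bk; apply: IH.
  rewrite -[wcomp _ w](subrK (Phi (wcomp (phiV (iter k phiV x)) w))).
  exact/boundsD/bounds_Phi.
(* One more iterate than there are first letters in w. *)
pose s := [seq iter k phiV x | k <- iota 0 (size (heads w)).+1].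
have us : uniq s.
  rewrite map_inj_in_uniq ?iota_uniq // => i j _ _.
  by rewrite !iter_phiV_phiz => /phiz_inj/oppr_inj[].
have sw : {subset s <= heads w}.
  move=> _ /mapP[k _ ->]; apply/negPn/negP => /wcomp_out wk.
  by apply: (nbk k); rewrite wk; apply: bounds0.
by have := uniq_leq_size us sw; rewrite size_map size_iota ltnn.
Qed.

(** Once deleting the first letter gives 0, [wcomp_CRd] reduces d(z') = 0 to the vanishing of every
    d(w_x). The letter x0 is only used to build the correcting boundary. *)
Lemma cycle_normal_form n x0 (z : C n.+2) : CRd X n.+2 z = 0 ->
  exists2 z', bounds (z - z') &
    wbehead z' = 0 /\ forall x, CRd X n.+1 (wcomp x z') = 0.
Proof.
(* The component at x of d(z) = 0 exhibits w_x - phi(w_y), where y = [phiV x] and w = [wbehead z],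
   as the boundary of [wcomp x z]. *)
move=> dz; have bw : forall x, bounds (wcomp x (wbehead z)).
  apply: bounds_wcomp => x; exists (wcomp x z).
  have := wcomp_CRd x z; rewrite dz raddf0 => /esym/eqP;
    rewrite subr_eq0 => /eqP <-.
  by rewrite -{2}[x]phiVK wcomp_Phi.
have [v dv] := choice bw.
(* Deleting the first letter of d(x0 y v_y) leaves v_y - phi(v_y) - (v_y - phi(v_y) - y d(v_y)) = y
   d(v_y), so these terms add up to [wbehead z]. *)
pose t := \sum_(y <- heads (wbehead z)) wcons x0 (wcons y (v y)).
have tz : wbehead (CRd X n.+3 t) = wbehead z.
  rewrite /t (raddf_sum (CRd X n.+3)) (raddf_sum wbehead) -[RHS]wcomp_sum.
  apply: eq_bigr => y _.
  by rewrite !CRd_cons dv !(raddfB wbehead) wmap_behead !wbeheadK opprB subrKC.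
have z'0 : wbehead (z - CRd X n.+3 t) = 0 by rewrite raddfB tz subrr.
exists (z - CRd X n.+3 t); first by exists t; rewrite opprB subrKC.
split=> // x; have := wcomp_CRd x (z - CRd X n.+3 t).
rewrite z'0 (raddf0 (@wmap _ _ phi _)) (raddf0 (wcomp x)) subr0 sub0r.
by rewrite raddfB dz CRd_CRd subr0 raddf0 => /esym/eqP;
  rewrite oppr_eq0 => /eqP.
Qed.

(** A nonzero combination of nonempty words contains a letter; this disposes of the empty rack. *)
Lemma word_eq0 n (z : C n.+1) : (X -> z = 0) -> z = 0.
Proof.
move=> X0; have [/eqP|] := eqVneq (dom z) [::];
  first by rewrite dom_eq0 => /eqP.
by case: (dom z) => // t _ _; apply/X0/(thead t).
Qed.

(** The converse of [proj_CRd] for cycles, which makes the isomorphism injective. *)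
Lemma cycle_bounds n (z : C n.+1) :
  CRd X n.+1 z = 0 -> proj z = 0 -> bounds z.
Proof.
elim: n z => [|n IH] z dz pz.
  (* In degree 1 each letter is homologous to the representative of its orbit, and the resulting
     chain depends only on the projection of z. *)
  pose e x := repr (orb x).
  have pe : wmap e z = 0 by rewrite -(wmap_comp orb (fun s => repr s))
    pz raddf0.
  suff : bounds (z - wmap e z) by rewrite pe subr0.
  move: z {dz pz pe}; apply: freeg_ind => [|t|u v bu bv].
  - by rewrite raddf0 subr0; apply: bounds0.
  - rewrite wordU wmap_cons tuple0 wmap_nil.
    by apply: bounds_orbit => [u|]; [apply: bounds_letter | rewrite /e reprK].
  - by rewrite raddfB opprD addrACA -opprD; apply: boundsB.
case: (pselect (inhabited X)) => [[x0]|nX]; last first.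
  by rewrite (@word_eq0 _ z) => [|x]; [apply: bounds0 | case: nX].
have [z' zz' [z'0 dz']] := cycle_normal_form x0 dz.
have {}pz : proj z' = 0 by rewrite -(proj_bounds zz').
rewrite -[z](subrK z'); apply: boundsD => //.
pose S := undup [seq orb x | x <- heads z'].
(* The projection of [w s] is the component at s of the projection of z', hence 0, so by induction
   [w s] is a boundary. *)
pose w s := \sum_(x <- heads z' | orb x == s) wcomp x z'.
have swE (M : zmodType) (F : orbits X -> {additive C n.+1 -> M}) :
    \sum_(s <- S) F s (w s) = \sum_(x <- heads z') F (orb x) (wcomp x z').
  under eq_bigr do rewrite raddf_sum.
  rewrite (exchange_big_dep predT) //=; apply: eq_big_seq => x xz.
  rewrite -big_filter (eq_filter (a2 := pred1 (orb x)));
    last by move=> s; apply: eq_sym.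
  by rewrite filter_pred1_uniq ?undup_uniq ?big_seq1 // mem_undup map_f.
have bw s : bounds (w s).
  apply: IH; first by rewrite raddf_sum big1.
  transitivity (wcomp s (proj z')); last by rewrite pz raddf0.
  rewrite -[in RHS](wcomp_sum z') !(raddf_sum (@wmap _ _ orb _)) big_mkcond.
  rewrite (raddf_sum (wcomp s)).
  by apply: eq_bigr => x _; rewrite wmap_cons wcompC; case: ifP.
have [v dv] := choice bw.
have w0 : \sum_(s <- S) w s = 0.
  by rewrite (swE _ (fun=> idfun)) -wbeheadE.
(* With d(v_s) = w_s, the boundary of (x0 - s) v_s is (s - x0) w_s, and the terms x0 w_s cancel
   because the w_s add up to 0. *)
have bS : bounds (\sum_(s <- S) wcons (repr s) (w s)).
  have -> : \sum_(s <- S) wcons (repr s) (w s) =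
      CRd X n.+3 (\sum_(s <- S) (wcons x0 (v s) - wcons (repr s) (v s))).
    have E : wcons x0 (\sum_(s <- S) w s) = 0 by rewrite w0 raddf0.
    rewrite (raddf_sum (CRd X n.+3)) -[LHS]subr0 -[X in _ - X]E.
    rewrite (raddf_sum (wcons x0)) -sumrB.
    apply: eq_bigr => s _; rewrite (raddfB (CRd X n.+3)) !CRd_cons !dv opprB.
    by rewrite [RHS]addrC addrA subrK.
  by exists (\sum_(s <- S) (wcons x0 (v s) - wcons (repr s) (v s))).
(* What remains is the sum of (x - x') w_x, with x' the representative of the orbit of x and w_x a
   cycle. *)
rewrite -[z'](subrK (\sum_(s <- S) wcons (repr s) (w s))).
apply: boundsD => //.
rewrite (swE _ (fun s => wcons (repr s))) -{1}(wcomp_sum z') -sumrB.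
apply: bounds_sum => x _; apply: bounds_orbit; last by rewrite reprK.
by move=> u; apply/bounds_phi/dz'.
Qed.

End Cycles.

(** * Words and tensors *)

Section TensorAdditive.
Variables A B : zmodType.

Lemma tensor_additive_ext (M : zmodType) (f g : {additive tensor A B -> M}) :
  (forall a b, f (pure a b) = g (pure a b)) -> f =1 g.
Proof.
move=> fg; elim/quotW; apply: (freeg_additive_ext
  (f := f \o \pi_(tensor A B)%qT)
  (g := g \o \pi_(tensor A B)%qT)) => -[a b]; exact: fg.
Qed.

Fact pure_is_zmod_morphism a : zmod_morphism (@pure A B a).
Proof.
by move=> b b'; apply/eqP; rewrite eq_sym subr_eq -pureDr subrK.
Qed.

HB.instance Definition _ a := GRing.isZmodMorphism.Build _ _ (@pure A B a)
  (pure_is_zmod_morphism a).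

(** [pure] with its arguments swapped, so that additivity in the left factor can be an instance as
    well. *)
Definition purel b a : tensor A B := pure a b.

Fact purel_is_zmod_morphism b : zmod_morphism (purel b).
Proof.
by move=> a a'; apply/eqP; rewrite eq_sym subr_eq -pureDl subrK.
Qed.

HB.instance Definition _ b := GRing.isZmodMorphism.Build _ _ (purel b)
  (purel_is_zmod_morphism b).

End TensorAdditive.

Section IntScale.
Variables (A : zmodType) (x : A).

Definition scalez (m : int) : A := x *~ m.

Fact scalez_is_zmod_morphism : zmod_morphism scalez.
Proof. by move=> m n; rewrite /scalez mulrzBr. Qed.

HB.instance Definition _ := GRing.isZmodMorphism.Build _ _ scalez
  scalez_is_zmod_morphism.
End IntScale.

(** * The map from words to tensors and its one-sided inverse *)

Section Target.
Variable S : choiceType.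
Implicit Types (s : S) (n : nat).

Local Notation W n := {freeg (n.-tuple S)}.
Local Notation T n := (tensor (tensor_pow (aug S) n) {freeg S}).

(* A basepoint of S; it does not depend on s, which only witnesses that S is
   inhabited. *)
Definition base s : S := choose predT s.

Lemma baseE s s' : base s = base s'.
Proof. exact: choose_id. Qed.

Fact aug_gen_subproof s :
  (<< s >> - << base s >> : {freeg S}) \in  kerp (@deg S).
Proof. by rewrite inE raddfB /= !degU subrr. Qed.

Definition aug_gen s : aug S := Kernel (aug_gen_subproof s).

Definition aug_retract : {additive {freeg S} -> aug S} := zlift aug_gen.

(** [aug_retract] is D |-> D - deg(D) s_0, and the correction vanishes in degree 0. *)
Lemma aug_retractK (a : aug S) : aug_retract (kval a) = a.
Proof.
apply: val_inj; rewrite /=.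
have E D : kval (aug_retract D) = D - freeg_map base D.
  move: D; apply: (freeg_additive_ext (f := val \o aug_retract)
    (g := idfun \- freeg_map base)) => s /=.
  by rewrite !zliftU.
rewrite E; apply/eqP; rewrite subr_eq addrC -subr_eq subrr eq_sym; apply/eqP.
have [/eqP|] := eqVneq (dom (kval a)) [::].
  by rewrite dom_eq0 => /eqP ->; rewrite raddf0.
case: (dom (kval a)) => // s _ _.
have -> D : freeg_map base D = << base s >> *~ deg D.
  move: D; apply: (freeg_additive_ext (f := freeg_map base)
    (g := scalez << base s >> \o @deg S)) => s'.
  by rewrite [LHS]zliftU [RHS]/= /scalez degU mulr1z (baseE s' s).
by rewrite (kvalP a) mulr0z.
Qed.

Definition tensor_cons_fun n (a : aug S) (p : tensor_pow (aug S) n) D :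
    T n.+1 :=
  pure (pure a p) D.

Fact tensor_cons_Dl n a (p q : tensor_pow (aug S) n) D :
  tensor_cons_fun a (p + q) D = tensor_cons_fun a p D + tensor_cons_fun a q D.
Proof. by rewrite /tensor_cons_fun pureDr pureDl. Qed.

Fact tensor_cons_Dr n a (p : tensor_pow (aug S) n) D E :
  tensor_cons_fun a p (D + E) = tensor_cons_fun a p D + tensor_cons_fun a p E.
Proof. exact: pureDr. Qed.

(** Left multiplication by a, combined with the rebracketing of a # (p # D) as (a # p) # D. *)
Definition tensor_cons {n} a : {additive T n -> T n.+1} :=
  tensor_lift (@tensor_cons_Dl n a) (@tensor_cons_Dr n a).

Lemma tensor_consE n a (p : tensor_pow (aug S) n) D :
  tensor_cons a (pure p D) = pure (pure a p) D.
Proof. exact: tensor_liftE. Qed.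

#[global] Opaque tensor_cons.

Definition tensor_consl n (t : T n) a : T n.+1 := tensor_cons a t.

Fact tensor_consl_is_zmod_morphism n (t : T n) : zmod_morphism (tensor_consl t).
Proof.
move=> a b; rewrite /tensor_consl.
move: t; apply: (tensor_additive_ext (f := @tensor_cons n (a - b))
  (g := @tensor_cons n a \- @tensor_cons n b)) => p D /=.
rewrite !tensor_consE -[pure (a - b) p]/(purel p (a - b)).
by rewrite -[pure (purel _ _) _]/(purel D (purel p (a - b))) !raddfB.
Qed.

HB.instance Definition _ n (t : T n) := GRing.isZmodMorphism.Build _ _
  (tensor_consl t) (tensor_consl_is_zmod_morphism t).

(** The zeroth tensor power is [int], so the last letter s becomes 1 # s; it is the only letter from
    which the base point is not subtracted. *)
Fixpoint word_tensor n : n.+1.-tuple S -> T n :=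
  match n with
  | 0 => fun t => pure (1 : int) << thead t >>
  | n.+1 => fun t =>
      tensor_cons (aug_gen (thead t)) (word_tensor [tuple of behead t])
  end.

Definition to_tensor {n} : {additive W n.+1 -> T n} := zlift (@word_tensor n).

Lemma to_tensor_cons n s (w : W n.+1) :
  to_tensor (wcons s w) = tensor_cons (aug_gen s) (to_tensor w).
Proof.
move: w; apply: (freeg_additive_ext (f := @to_tensor n.+1 \o wcons s)
  (g := tensor_cons (aug_gen s) \o @to_tensor n)) => t /=.
rewrite wconsU !zliftU /= theadE; congr (tensor_cons _ (word_tensor _)).
exact: val_inj.
Qed.

Lemma to_tensor_letter (t : 1.-tuple S) :
  to_tensor << t >> = pure (1 : int) << thead t >>.
Proof. exact: zliftU. Qed.

#[global] Opaque to_tensor.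

Lemma to_tensor_wmul n D (w : W n.+1) :
  to_tensor (wmul w D) = tensor_cons (aug_retract D) (to_tensor w).
Proof.
move: D; apply: (freeg_additive_ext (f := to_tensor \o wmul w)
  (g := tensor_consl (to_tensor w) \o aug_retract)) => s /=.
by rewrite wmulU to_tensor_cons /tensor_consl zliftU.
Qed.

Definition wmulr n D (w : W n) : W n.+1 := wmul w D.

Fact wmulr_is_zmod_morphism n D : zmod_morphism (@wmulr n D).
Proof.
by move=> u v; apply/eqP; rewrite eq_sym subr_eq /wmulr -wmulDr subrK.
Qed.

HB.instance Definition _ n D := GRing.isZmodMorphism.Build _ _ (@wmulr n D)
  (@wmulr_is_zmod_morphism n D).

Section WordOfPowStep.
Variables (n : nat) (g : {additive tensor_pow (aug S) n -> W n.+1}).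

Fact word_of_pow_step_Dl (a b : aug S) p :
  wmul (g p) (kval (a + b)) = wmul (g p) (kval a) + wmul (g p) (kval b).
Proof. by rewrite -raddfD. Qed.

Fact word_of_pow_step_Dr (a : aug S) p q :
  wmul (g (p + q)) (kval a) = wmul (g p) (kval a) + wmul (g q) (kval a).
Proof. by rewrite raddfD wmulDr. Qed.

(** Stated over an arbitrary additive g, so that the recursion below can return bundled additive
    maps. *)
Definition word_of_pow_step : {additive tensor_pow (aug S) n.+1 -> W n.+2} :=
  tensor_lift word_of_pow_step_Dl word_of_pow_step_Dr.
End WordOfPowStep.

Fixpoint word_of_pow D n : {additive tensor_pow (aug S) n -> W n.+1} :=
  match n with
  | 0 => scalez (wmul << [tuple] >> D)
  | n.+1 => word_of_pow_step (word_of_pow D n)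
  end.

Lemma word_of_powS D n a p :
  word_of_pow D n.+1 (pure a p) = wmul (word_of_pow D n p) (kval a).
Proof.
exact: (tensor_liftE (word_of_pow_step_Dl (word_of_pow D n))
                     (word_of_pow_step_Dr (word_of_pow D n))).
Qed.

Fact word_of_pow_Dl n p q D :
  word_of_pow D n (p + q) = word_of_pow D n p + word_of_pow D n q.
Proof. exact: raddfD. Qed.

Fact word_of_pow_Dr n p D E :
  word_of_pow (D + E) n p = word_of_pow D n p + word_of_pow E n p.
Proof.
elim: n p => [|n IH]; first by move=> p; rewrite /= /scalez raddfD mulrzDl.
apply: (tensor_additive_ext (f := word_of_pow (D + E) n.+1)
  (g := word_of_pow D n.+1 \+ word_of_pow E n.+1)) => a p.
by rewrite word_of_powS IH wmulDr -!word_of_powS.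
Qed.

(** Multiplying out: a_1 # ... # a_n # D goes to a_1 ... a_n D. By [proj_cycle] and [cycle_lift],
    the image consists exactly of the projections of cycles. *)
Definition of_tensor {n} : {additive T n -> W n.+1} :=
  tensor_lift (@word_of_pow_Dl n) (@word_of_pow_Dr n).

#[global] Opaque word_of_pow.

Lemma of_tensorE n p D : of_tensor (pure p D) = word_of_pow D n p.
Proof. exact: tensor_liftE. Qed.

#[global] Opaque of_tensor.

Lemma of_tensor_cons n a (t : T n) :
  of_tensor (tensor_cons a t) = wmul (of_tensor t) (kval a).
Proof.
move: t; apply: (tensor_additive_ext (f := @of_tensor n.+1 \o tensor_cons a)
  (g := wmulr (kval a) \o @of_tensor n)) => p D.
by rewrite /wmulr [LHS]/= [RHS]/= tensor_consE !of_tensorE word_of_powS.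
Qed.

Lemma of_to_tensor0 (w : W 1) : of_tensor (to_tensor w) = w.
Proof.
move: w; apply: (freeg_additive_ext (f := @of_tensor 0 \o to_tensor)
  (g := idfun)) => t.
rewrite [LHS]/= to_tensor_letter of_tensorE [LHS]mulr1z wmulU [RHS]wordU.
by congr (wcons _ << _ >>); apply/esym/tuple0.
Qed.

Lemma of_to_tensor_cons n s (w : W n.+1) :
  of_tensor (to_tensor (wcons s w)) =
  wcons s (of_tensor (to_tensor w)) - wcons (base s) (of_tensor (to_tensor w)).
Proof. by rewrite to_tensor_cons of_tensor_cons raddfB !wmulU. Qed.

(** Each factor a has degree 0 and is therefore recovered by [aug_retract]. Consequently
    [of_tensor \o to_tensor] is idempotent. *)
Lemma of_tensorK n : cancel (@of_tensor n) to_tensor.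
Proof.
apply: (tensor_additive_ext (f := to_tensor \o @of_tensor n)
  (g := idfun)) => p D.
rewrite [LHS]/= [RHS]/= of_tensorE; elim: n p => [|n IH].
  move=> p; rewrite [LHS]raddfMz -[p in RHS]intz -[_%:~R]/(1 *~ p).
  rewrite -/(purel D (1 *~ p)) raddfMz; congr (_ *~ _); move: D.
  apply: (freeg_additive_ext (f := @to_tensor 0 \o wmul << [tuple] >>)
    (g := pure 1)) => s.
  by rewrite [LHS]/= wmulU wconsU to_tensor_letter.
apply: (tensor_additive_ext (f := to_tensor \o word_of_pow D n.+1)
  (g := purel D)) => a p.
by rewrite [LHS]/= word_of_powS to_tensor_wmul aug_retractK IH tensor_consE.
Qed.

End Target.

Arguments to_tensor {S n}.
Arguments of_tensor {S n}.

(** * The isomorphism *)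

Section Naturality.
Variables (S S' : choiceType) (f : S -> S').

(** f need not preserve base points; the base point of S' cancels in the difference. *)
Lemma aug_map_gen s :
  aug_map f (aug_gen s) = aug_gen (f s) - aug_gen (f (base s)).
Proof.
apply: val_inj; rewrite [LHS]raddfB /= !zliftU.
by rewrite (baseE (f (base s)) (f s)) opprB addrA subrK.
Qed.

Local Notation T n := (tensor_map (tensor_pow_map (aug_map f) n) (freeg_map f)).

Lemma tensor_map_cons n a t :
  T n.+1 (tensor_cons a t) = tensor_cons (aug_map f a) (T n t).
Proof.
move: t; apply: (tensor_additive_ext (f := T n.+1 \o tensor_cons a)
  (g := tensor_cons (aug_map f a) \o T n)) => p D.
rewrite -[LHS]/(T n.+1 (tensor_cons a (pure p D))) tensor_consE.
rewrite -[RHS]/(tensor_cons _ (T n (pure p D))) !tensor_mapE tensor_consE.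
by congr (pure _ _); apply: tensor_mapE.
Qed.

(** As f may move the base point, [to_tensor] alone is not natural in general. It becomes so after
    the idempotent [of_tensor \o to_tensor], which fixes projections of cycles. *)
Lemma to_tensor_natural n (w : {freeg (n.+1.-tuple S)}) :
  to_tensor (wmap f (of_tensor (to_tensor w))) = T n (to_tensor w).
Proof.
elim: n w => [|n IH].
  move=> w; rewrite of_to_tensor0; move: w.
  apply: (freeg_additive_ext (f := to_tensor \o wmap f)
  (g := T 0 \o to_tensor)) => t.
  rewrite -[RHS]/(T 0 (to_tensor << t >>)) [LHS]/= to_tensor_letter tensor_mapE.
  rewrite wordU wmap_cons tuple0 wmap_nil wconsU to_tensor_letter theadE.
  by congr (pure _ _); rewrite [RHS]zliftU.
apply: (freeg_additive_ext
  (f := to_tensor \o @wmap _ _ f _ \o of_tensor \o to_tensor)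
  (g := T n.+1 \o to_tensor)) => t.
rewrite -[RHS]/(T n.+1 (to_tensor << t >>)) [LHS]/= wordU of_to_tensor_cons.
rewrite (raddfB (wmap f)) raddfB !wmap_cons !to_tensor_cons IH tensor_map_cons.
by rewrite aug_map_gen -[RHS]/(tensor_consl _ _) raddfB.
Qed.

End Naturality.

Lemma inj_surj_bijective (T U : Type) (f : T -> U) :
  injective f -> (forall u, exists t, f t = u) -> bijective f.
Proof.
move=> fI /choice[g gK]; exists g => // t; exact: fI.
Qed.

Section HomologyOfRack.
Variable X : freePermRack.
Implicit Types (x y : X) (n : nat).

Local Notation C n := {freeg (n.-tuple X)}.
Local Notation orb := (\pi_(orbits X)%qT : X -> orbits X).
Local Notation proj := (wmap orb).

Lemma proj_cycle n (z : C n.+1) : CRd X n.+1 z = 0 ->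
  of_tensor (to_tensor (proj z)) = proj z.
Proof.
elim: n z => [|n IH] z dz; first exact: of_to_tensor0.
case: (pselect (inhabited X)) => [[x0]|nX]; last first.
  by rewrite (@word_eq0 _ _ z) ?raddf0 // => x; case: nX.
have [z' /proj_bounds -> [z'0 dz']] := cycle_normal_form x0 dz.
have pz : proj z' = \sum_(x <- heads z') wcons (orb x) (proj (wcomp x z')).
  rewrite -{1}(wcomp_sum z') (raddf_sum (@wmap _ _ orb _)).
  by apply: eq_bigr => x _; rewrite wmap_cons.
rewrite pz (raddf_sum to_tensor) (raddf_sum of_tensor).
pose s0 := base (orb x0).
(* In normal form the w_x add up to 0, so subtracting s0 w_x from every term changes nothing. *)
transitivity (\sum_(x <- heads z') wcons (orb x) (proj (wcomp x z')) -
              \sum_(x <- heads z') wcons s0 (proj (wcomp x z'))).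
  rewrite -sumrB; apply: eq_bigr => x _.
  by rewrite of_to_tensor_cons IH // (baseE _ (orb x0)).
rewrite -(raddf_sum (wcons s0)) -(raddf_sum (@wmap _ _ orb _)) -wbeheadE z'0.
by rewrite (raddf0 (@wmap _ _ orb _)) (raddf0 (wcons s0)) subr0.
Qed.

(** By induction, a product (s - s_0) m' with m' the projection of a cycle z lifts to (x - x_0) z
    for representatives x and x_0. *)
Lemma cycle_lift n (m : {freeg (n.+1.-tuple (orbits X))}) :
  exists2 z : C n.+1, CRd X n.+1 z = 0 & proj z = of_tensor (to_tensor m).
Proof.
elim: n m => [|n IH]; apply: freeg_ind.
- by exists 0; rewrite ?raddf0.
- move=> t; exists << [tuple repr (thead t)] >>; first exact: CRd1.
  rewrite of_to_tensor0 wordU wmap_cons theadE reprK [RHS]wordU;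
    congr (wcons _ _).
  by rewrite tuple0 wmap_nil; congr << _ >>; apply/esym/tuple0.
- move=> u v [z dz zu] [w dw wv]; exists (z - w);
    first by rewrite raddfB dz dw subrr.
  by rewrite !raddfB zu wv.
- by exists 0; rewrite ?raddf0.
- move=> t; have [z dz pz] := IH << [tuple of behead t] >>.
  (* The two copies of z - phi(z) in the differential cancel, and d(z) = 0 removes the other
     terms. *)
  exists (wcons (repr (thead t)) z - wcons (repr (base (thead t))) z).
    by rewrite raddfB !CRd_cons dz !(raddf0 (@wcons X n _)) subrr.
  by rewrite raddfB !wmap_cons pz !reprK [in RHS]wordU of_to_tensor_cons.
- move=> u v [z dz zu] [w dw wv]; exists (z - w);
    first by rewrite raddfB dz dw subrr.
  by rewrite !raddfB zu wv.
Qed.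

Definition cycle_tensor n (z : kernel (CRd X n.+1)) :
    tensor (tensor_pow (aug (orbits X)) n) {freeg (orbits X)} :=
  to_tensor (proj (kval z)).

Fact cycle_tensor_is_zmod_morphism n : zmod_morphism (@cycle_tensor n).
Proof. by move=> z w; rewrite /cycle_tensor -!raddfB. Qed.

HB.instance Definition _ n := GRing.isZmodMorphism.Build _ _ (@cycle_tensor n)
  (@cycle_tensor_is_zmod_morphism n).

Fact cycle_tensor_bounds n (z : kernel (CRd X n.+1)) :
  z \in boundaryb (CRd X n.+2) (CRd X n.+1) -> cycle_tensor z = 0.
Proof. by move=> /asboolP[v dv]; rewrite /cycle_tensor -dv proj_CRd raddf0. Qed.

Definition HR_tensor n : {additive HR X n.+1 ->
    tensor (tensor_pow (aug (orbits X)) n) {freeg (orbits X)}} :=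
  quot_lift (@cycle_tensor_bounds n).

Lemma HR_tensorE n z :
  HR_tensor n (hclass (CRd X n.+2) z) = to_tensor (proj (kval z)).
Proof. exact: quot_liftE. Qed.

Lemma hclass_eq0 n (z : kernel (CRd X n)) : bounds (kval z) ->
  hclass (CRd X n.+1) z = 0.
Proof.
move=> bz; apply/eqP; rewrite /hclass -[0](raddf0 \pi_(HR X n)%qT).
by rewrite -Quotient.idealrBE subr0; apply/asboolP.
Qed.

(** The tensor determines the projection of a cycle by [proj_cycle], and the projection determines
    its class by [cycle_bounds]. *)
Lemma HR_tensor_inj n : injective (HR_tensor n).
Proof.
apply: raddf_inj; elim/quotW => z;
  rewrite -/(hclass (CRd X n.+2) z) HR_tensorE => z0.
apply/hclass_eq0/cycle_bounds; first exact: kvalP.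
by rewrite -proj_cycle ?kvalP // z0 raddf0.
Qed.

Lemma HR_tensor_surj n t : exists z, HR_tensor n z = t.
Proof.
have [z /eqP dz pz] := cycle_lift (of_tensor t).
exists (hclass (CRd X n.+2) (@Kernel _ _ (CRd X n.+1) z dz)).
by rewrite HR_tensorE /= pz !of_tensorK.
Qed.

Lemma HR_tensor_bij n : bijective (HR_tensor n).
Proof.
exact: inj_surj_bijective (@HR_tensor_inj n) (@HR_tensor_surj n).
Qed.

End HomologyOfRack.

Lemma HR_tensor_natural (X Y : freePermRack) (F : permRackHom X Y) n
    (z : HR X n.+1) :
  HR_tensor Y n (HR_map F n.+1 z) =
  tensor_map (tensor_pow_map (aug_map (orbits_map F)) n)
    (freeg_map (orbits_map F)) (HR_tensor X n z).
Proof.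
elim/quotW: z => z; rewrite -/(hclass (CRd X n.+2) z).
rewrite /HR_map homology_mapE !HR_tensorE.
rewrite -[kval (kernel_map _ z)]/(wmap F (kval z)) -to_tensor_natural
  proj_cycle ?kvalP // !wmap_comp; congr (to_tensor _).
by apply: eq_wmap => x /=; rewrite orbits_mapE.
Qed.

(** * Free abelian groups and ranks *)

Lemma additive_inverse (U V : zmodType) (f : {additive U -> V}) : bijective f ->
  exists g : {additive V -> U}, cancel f g /\ cancel g f.
Proof.
case=> g fK gK; pose gm := GRing.isZmodMorphism.Build V U g
  (can2_zmod_morphism fK gK).
by pose gA : {additive V -> U} := HB.pack g gm; exists gA.
Qed.

(** Freeness with the basis type kept visible, so that finite bases can be counted. *)
Definition free_on (K : choiceType) (A : zmodType) :=
  exists f : {additive {freeg K} -> A}, bijective f.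

Lemma free_on_iso (K : choiceType) (A B : zmodType) (f : {additive A -> B}) :
  bijective f -> free_on K A -> free_on K B.
Proof.
by move=> fb [g gb]; exists (f \o g : {additive _ -> _}); apply: bij_comp.
Qed.

Lemma free_on_isoV (K : choiceType) (A B : zmodType) (f : {additive A -> B}) :
  bijective f -> free_on K B -> free_on K A.
Proof.
move=> /additive_inverse[g [fK gK]]; apply: (@free_on_iso _ _ _ g).
by exists f.
Qed.

Lemma freeg_map_bij (K L : choiceType) (h : K -> L) :
  bijective h -> bijective (freeg_map h).
Proof.
case=> g hK gK; exists (freeg_map g).
- apply: (freeg_additive_ext (f := freeg_map g \o freeg_map h)
  (g := idfun)) => x.
  by rewrite [LHS]/= !zliftU hK.
- apply: (freeg_additive_ext (f := freeg_map h \o freeg_map g)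
  (g := idfun)) => x.
  by rewrite [LHS]/= !zliftU gK.
Qed.

Lemma free_on_bij (K L : choiceType) (A : zmodType) (h : L -> K) :
  bijective h -> free_on K A -> free_on L A.
Proof.
move=> hb [f fb]; exists (f \o freeg_map h : {additive _ -> _}).
exact/(bij_comp fb)/freeg_map_bij.
Qed.

Lemma tensor_map_bij (A B A' B' : zmodType)
    (f : {additive A -> A'}) (g : {additive B -> B'}) :
  bijective f -> bijective g -> bijective (tensor_map f g).
Proof.
move=> /additive_inverse[f' [fK f'K]] /additive_inverse[g' [gK g'K]].
exists (tensor_map f' g').
- apply: (tensor_additive_ext (f := tensor_map f' g' \o tensor_map f g)
    (g := idfun)) => a b.
  by rewrite -[LHS]/(tensor_map f' g' (tensor_map f g _)) !tensor_mapE fK gK.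
- apply: (tensor_additive_ext (f := tensor_map f g \o tensor_map f' g')
    (g := idfun)) => a b.
  by rewrite -[LHS]/(tensor_map f g (tensor_map f' g' _)) !tensor_mapE f'K g'K.
Qed.

Section TensorFreeg.
Variables K L : choiceType.

(** The bilinear map whose value has coefficient D_x E_y at (x, y). *)
Definition freeg_pair (D : {freeg K}) (E : {freeg L}) : {freeg (K * L)%type} :=
  zlift (fun x => freeg_map (pair x) E) D.

Fact freeg_pair_Dl D D' E :
  freeg_pair (D + D') E = freeg_pair D E + freeg_pair D' E.
Proof. exact: raddfD. Qed.

Fact freeg_pair_Dr D E E' :
  freeg_pair D (E + E') = freeg_pair D E + freeg_pair D E'.
Proof.
move: D; apply: (freeg_additive_ext
  (f := zlift (fun x => freeg_map (pair x) (E + E')))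
  (g := zlift (fun x => freeg_map (pair x) E) \+
        zlift (fun x => freeg_map (pair x) E'))).
by move=> x; rewrite -[RHS]/(zlift _ _ + zlift _ _) !zliftU [LHS]zliftU raddfD.
Qed.

Lemma free_on_tensor_freeg :
  free_on (K * L)%type (tensor {freeg K} {freeg L}).
Proof.
pose f : {additive {freeg (K * L)%type} -> tensor {freeg K} {freeg L}} :=
  zlift (fun p => pure << p.1 >> << p.2 >>).
pose g : {additive tensor {freeg K} {freeg L} -> {freeg (K * L)%type}} :=
  tensor_lift freeg_pair_Dl freeg_pair_Dr.
have fE x y : f << (x, y) >> = pure << x >> << y >> by exact: zliftU.
have gE D E : g (pure D E) = freeg_pair D E by exact: tensor_liftE.
exists f; exists g.
  apply: (freeg_additive_ext (f := g \o f) (g := idfun)) => -[x y].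
  by rewrite -[LHS]/(g (f _)) fE gE /freeg_pair zliftU; apply: zliftU.
apply: (tensor_additive_ext (f := f \o g) (g := idfun)) => D E.
rewrite -[LHS]/(f (g _)) gE; move: D.
apply: (freeg_additive_ext (f := f \o zlift (fun x => freeg_map (pair x) E))
  (g := purel E)) => x.
rewrite -[LHS]/(f (zlift _ _)) zliftU -[RHS]/(pure _ _); move: E.
apply: (freeg_additive_ext (f := f \o freeg_map (pair x))
  (g := pure << x >>)) => y.
by transitivity (f << (x, y) >>); [congr (f _); apply: zliftU | apply: fE].
Qed.

End TensorFreeg.

Lemma free_on_tensor (K L : choiceType) (A B : zmodType) :
  free_on K A -> free_on L B -> free_on (K * L)%type (tensor A B).
Proof.
move=> [f fb] [g gb]; apply: (free_on_iso (tensor_map_bij fb gb)).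
exact: free_on_tensor_freeg.
Qed.

Lemma free_on_int : free_on unit int.
Proof.
exists (@deg unit); exists (scalez << tt >>).
- apply: (freeg_additive_ext (f := scalez << tt >> \o @deg unit)
  (g := idfun)) => -[].
  by rewrite -[LHS]/(_ *~ deg _) degU.
- by move=> m; rewrite /scalez raddfMz -[LHS]/(deg << tt >> *~ m) degU intz.
Qed.

Lemma free_on_tensor_pow (K : choiceType) (A : zmodType) n :
  free_on K A -> is_free_abelian (tensor_pow A n).
Proof.
move=> KA; elim: n => [|n [L LA]]; first by exists unit; apply: free_on_int.
by exists (K * L)%type; apply: (free_on_tensor KA LA).
Qed.

Lemma ord_bij (T : finType) N : #|T| = N -> exists h : 'I_N -> T, bijective h.
Proof. by move=> <-; exists enum_val; apply: enum_val_bij. Qed.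

Lemma free_on_ord_tensor (A B : zmodType) k l :
  free_on 'I_k A -> free_on 'I_l B -> free_on 'I_(k * l) (tensor A B).
Proof.
move=> kA lB; have [|h hb] := @ord_bij ('I_k * 'I_l)%type (k * l).
  by rewrite card_prod !card_ord.
exact/(free_on_bij hb)/free_on_tensor.
Qed.

Lemma free_on_ord_tensor_pow (A : zmodType) k n :
  free_on 'I_k A -> free_on 'I_(k ^ n) (tensor_pow A n).
Proof.
move=> kA; elim: n => [|n IH]; last by rewrite expnS; apply: free_on_ord_tensor.
have [|h hb] := @ord_bij unit 1; first exact: card_unit.
exact/(free_on_bij hb)/free_on_int.
Qed.

(** With more rows than columns there is a nonzero rational vector in the left kernel; its
    denominators are then cleared. *)
Lemma int_kernel_vector k l (M : 'M[int]_(k, l)) : (l < k)%N ->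
  exists2 c : 'I_k -> int, exists i, c i != 0 & forall j,
    \sum_i M i j * c i = 0.
Proof.
move=> lk; pose A : 'M[rat]_(k, l) := map_mx intr M.
have : kermx A != 0.
  rewrite -mxrank_eq0 mxrank_ker -lt0n subn_gt0.
  exact: leq_ltn_trans (rank_leq_col _) lk.
case/rowV0Pn=> u /sub_kermxP uA /rV0Pn[i ui].
(* This is u_j times the product of all denominators, written without division. *)
pose c j := numq (u 0 j) * \prod_(t | t != j) denq (u 0 t).
have cE j : (c j)%:~R = u 0 j * (\prod_t denq (u 0 t))%:~R :> rat.
  by rewrite (bigD1 j) //= !rmorphM /= numqE mulrA.
exists c.
  exists i; rewrite mulf_neq0 ?numq_eq0 //.
  by apply/prodf_neq0 => t _; apply: denq_neq0.
move=> j; apply: (@intr_inj rat); rewrite rmorph_sum /=.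
have := congr1 (fun w : 'rV_l => w 0 j * (\prod_t denq (u 0 t))%:~R) uA.
rewrite /= !mxE mul0r mulr_suml mulr0z => c0; apply: etrans c0;
  apply: eq_bigr => t _.
by rewrite intrM cE mxE [RHS]mulrAC mulrC.
Qed.

(** The basis is independent, and the coordinates of more than N elements satisfy an integer
    relation by [int_kernel_vector]. *)
Lemma free_on_ord_rank (A : zmodType) N : free_on 'I_N A -> has_rank A N.
Proof.
move=> [f fb]; have [g [fK gK]] := additive_inverse fb.
split.
  exists (fun i => f << i >>) => c c0 i.
  have : f (\sum_i << i >> *~ c i) = 0.
    by rewrite raddf_sum; apply: etrans c0; apply: eq_bigr => j _;
      rewrite raddfMz.
  rewrite -(raddf0 f) => /(bij_inj fb)/(congr1 (coeff i)).
  rewrite coeff0 raddf_sum (bigD1 i) //= freegU_mulz coeffU eqxx mulr1 intz.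
  rewrite big1 ?addr0 // => j ji.
  by rewrite freegU_mulz coeffU (negPf ji) mulr0.
move=> k v vI; rewrite leqNgt; apply/negP => Nk.
have [c [i ci] c0] := int_kernel_vector (\matrix_(i, j) coeff j (g (v i))) Nk.
case/eqP: ci; apply: (vI c); apply: (can_inj gK); rewrite raddf0 raddf_sum.
apply/eqP/freeg_eqP => j; rewrite coeff0 !raddf_sum; apply: etrans (c0 j).
by apply: eq_bigr => t _; rewrite mxE !raddfMz /= -mulrzr intz.
Qed.

(** * A basis of the augmentation kernel *)

Section AugFree.
Variable S : choiceType.

Definition nonbase := {s : S | s != base s}.

(** The differences s - s_0 with s != s_0 form a basis; the inverse forgets the coefficient at
    s_0. *)
Lemma free_on_aug : free_on nonbase (aug S).
Proof.
pose f : {additive {freeg nonbase} -> aug S} :=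
  zlift (fun u => aug_gen (val u)).
pose ins (s : S) : {freeg nonbase} := if insub s is Some u then << u >> else 0.
pose h : {additive {freeg S} -> {freeg nonbase}} := zlift ins.
have fE u : f << u >> = aug_gen (val u) by exact: zliftU.
have hE s : h << s >> = ins s by exact: zliftU.
exists f; exists (fun a => h (kval a)).
  apply: (freeg_additive_ext (f := h \o val \o f) (g := idfun)) => u.
  rewrite -[LHS]/(h (kval (f _))) fE (raddfB h) !hE /ins valK insubF ?subr0 //.
  by rewrite (baseE _ (val u)) eqxx.
have E : f \o h =1 aug_retract S.
  apply: (freeg_additive_ext (f := f \o h)) => s.
  rewrite [RHS]zliftU -[LHS]/(f (h _)) hE /ins; case: insubP => [u _ <-|].
    exact: fE.
  rewrite negbK => /eqP sb; rewrite raddf0; apply: val_inj.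
  by rewrite /= -sb subrr.
by move=> a; rewrite -[LHS]/((f \o h) _) E aug_retractK.
Qed.

Lemma free_on_ord_aug r (h : 'I_r -> S) : bijective h ->
  free_on 'I_r.-1 (aug S).
Proof.
(* For r = 0 there are no orbits and [r.-1] is 0, so both index types are empty. *)
case: r h => [|r] h hb.
  pose k (i : 'I_0) : nonbase := False_rect _ (notF (ltn_ord i)).
  apply: (@free_on_bij _ 'I_0 _ k _ free_on_aug).
  apply: inj_surj_bijective => [i|u]; first by have := ltn_ord i.
  by case: hb => h' _ _; case: (h' (val u)).
(* i0 is the index of the base point, and [lift i0] enumerates the other indices. *)
have [h' hK h'K] := hb; pose i0 := h' (base (h ord0)).
have hP (i : 'I_r) : h (fintype.lift i0 i) != base (h (fintype.lift i0 i)).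
  rewrite (baseE _ (h ord0)) -[base _]h'K (inj_eq (bij_inj hb)).
  by rewrite eq_sym neq_lift.
pose k (i : 'I_r) : nonbase := exist _ (h (fintype.lift i0 i)) (hP i).
apply: (@free_on_bij _ 'I_r _ k _ free_on_aug).
apply: inj_surj_bijective =>
  [i j /(congr1 val)/(bij_inj hb)/lift_inj //|[s sb]].
have : i0 != h' s.
  rewrite -(inj_eq (bij_inj hb)) /i0 !h'K eq_sym.
  by rewrite (baseE _ s).
case/unlift_some => i si _; exists i; apply: val_inj => /=.
by rewrite -si h'K.
Qed.

End AugFree.

(** The differentials out of degrees 0 and 1 both vanish, so the homology in degree 0 is all of
    [CR X 0]. *)
Lemma free_on_HR0 (X : permRack) : free_on (0.-tuple X) (HR X 0).
Proof.
pose v : {additive kernel (CRd X 0) -> CR X 0} := val.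
have v0 z : z \in boundaryb (CRd X 1) (CRd X 0) -> v z = 0.
  by move=> /asboolP[u uz]; rewrite -[LHS]/(kval z) -uz; apply: CRd1.
apply: (free_on_isoV (f := quot_lift v0)); last by exists idfun; exists idfun.
apply: inj_surj_bijective.
  apply: raddf_inj; elim/quotW => z z0;
    have {}z0 : v z = 0 by rewrite -(quot_liftE v0).
  by rewrite (_ : z = 0) ?raddf0 //; apply: val_inj.
move=> u; have du : u \in kerp (CRd X 0).
  apply/eqP; move: u; apply: (freeg_additive_ext (f := CRd X 0) (g := \0)) => t.
  by rewrite CRdU big_ord0.
exists (hclass (CRd X 1) (@Kernel _ _ (CRd X 0) u du)).
exact: quot_liftE.
Qed.

Lemma card_ord_bij (T : choiceType) r : ([set: T] #= `I_r)%card ->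
  exists h : 'I_r -> T, bijective h.
Proof.
case/card_set_bijP => f [fr fI fS].
have fP t : (f t < r)%N by apply: fr.
have : bijective (fun t => Ordinal (fP t)).
  apply: inj_surj_bijective => [t u /(congr1 val) /= tu|[i ir]].
    by apply: fI; rewrite ?inE.
  by have [t _ ti] := fS i ir; exists t; apply: val_inj.
by case=> g fK gK; exists g; exists (fun t => Ordinal (fP t)).
Qed.

Theorem theoremB :
  (forall n : nat, (1 <= n)%N ->
    exists theta : forall X : freePermRack,
        {additive HR X n ->
           tensor (tensor_pow (aug (orbits X)) n.-1) {freeg (orbits X)}},
      (forall X : freePermRack, bijective (theta X)) /\
      (forall (X Y : freePermRack) (F : permRackHom X Y) (z : HR X n),
         theta Y (HR_map F n z) =
         tensor_map (tensor_pow_map (aug_map (orbits_map F)) n.-1)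
           (freeg_map (orbits_map F)) (theta X z))) /\
  (forall X : freePermRack, is_free_abelian (aug (orbits X))) /\
  (forall (X : freePermRack) (n : nat), is_free_abelian (HR X n)) /\
  (forall (X : freePermRack) (n r : nat), (1 <= n)%N ->
     ([set: orbits X] #= `I_r)%card ->
     (exists2 b : nat, has_rank (HR X n) b &
        b%:Z = r%:Z * (r%:Z - 1) ^+ n.-1) /\
     r%:Z * (r%:Z - 1) ^+ n.-1 = (r%:Z - 1) ^+ n + (r%:Z - 1) ^+ n.-1).
Proof.
have freeS (T : choiceType) : free_on T {freeg T}.
  by exists idfun; exists idfun.
split=> [[//|n] _|].
  exists (fun X => HR_tensor X n); split;
    last by move=> X Y F z; apply: HR_tensor_natural.
  by move=> X; apply: HR_tensor_bij.
split=> [X|]; first by exists (nonbase (orbits X)); apply: free_on_aug.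
split=> [X [|n]|X [//|n] r _ /card_ord_bij[h hb]].
- by exists (0.-tuple X); apply: free_on_HR0.
- have [K Kpow] := free_on_tensor_pow n (free_on_aug (orbits X)).
  exists (K * orbits X)%type; apply: (free_on_isoV (HR_tensor_bij X n)).
  exact: free_on_tensor.
split; last by rewrite exprS -[X in _ = _ + X]mul1r -mulrDl subrK.
exists ((r.-1 ^ n) * r)%N.
  apply/free_on_ord_rank/(free_on_isoV (HR_tensor_bij X n)).
  apply: free_on_ord_tensor; last exact: free_on_bij hb _.
  exact/free_on_ord_tensor_pow/(free_on_ord_aug hb).
(* For r = 0 the natural number [r.-1] differs from the integer r - 1, but the factor r makes both
   sides 0. *)
rewrite mulnC PoszM; case: r {h hb} => [|r]; first by rewrite !mul0r.
have -> : r.+1%:Z - 1 = r%:Z by rewrite -addn1 PoszD addrK.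
congr (_ * _).
by elim: n => // n IH; rewrite expnS exprS PoszM IH.
Qed.
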